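(* Let $K$ be a compact Hausdorff space, and let $I_1, I_2, J_1, J_2$ be closed ideals in $C(K)$, countably generated as Hilbert $C(K)$-modules. If $I_1\subset\subset J_1$ and $I_2\subset\subset J_2$, then $I_1\otimes I_2\subset\subset J_1\otimes J_2$, where $I_1\otimes I_2$ and $J_1\otimes J_2$ are regarded as closed ideals of $C(K)\otimes C(K)\cong C(K\times K)$.
   Context: $C(K)$ is the C$^*$-algebra of continuous complex-valued functions on $K$, and $\otimes$ is the C$^*$-tensor product (unique here, since commutative C$^*$-algebras are nuclear). A closed two-sided ideal $I$ of a C$^*$-algebra $D$ is regarded as a Hilbert $D$-module with inner product $\langle x,y\rangle=x^*y$ and right multiplication. Compact containment: for countably generated Hilbert C$^*$-modules $X$ and $Y$ over the same C$^*$-algebra, with $X$ a (closed) Hilbert submodule of $Y$, one writes $X\subset\subset Y$ if there is a compact self-adjoint endomorphism $b$ of $Y$ which acts as the identity on $X$, i.e. $bx=x$ for all $x\in X$; a compact endomorphism of $Y$ is an element of $\mathcal{K}(Y)$, the norm-closed linear span of the operators $z\mapsto y\langle y',z\rangle$, $y,y'\in Y$. For closed two-sided ideals $I,J$ of a C$^*$-algebra, $I\subset\subset J$ means that the Hilbert C$^*$-module $I$ is compactly contained in the Hilbert C$^*$-module $J$. *)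

(* Defs.v *)
From HB Require Import structures.
From mathcomp Require Import all_boot all_order all_algebra.
From mathcomp Require Import boolp classical_sets functions cardinality reals.
From mathcomp Require Import topology normedtype.
From mathcomp Require Import complex.

Set Implicit Arguments.
Unset Strict Implicit.
Unset Printing Implicit Defensive.
Import Order.TTheory GRing.Theory Num.Theory numFieldNormedType.Exports.
Local Open Scope classical_set_scope.
Local Open Scope ring_scope.
Local Open Scope complex_scope.

(* Algebras are not assumed unital, hence an own product rather than the ring
   product.  Norms take their values in R[i], as for any [normedModType R[i]]. *)
HB.mixin Record isCStarAlgebra (R : realType) A
    of CompleteNormedModule R[i] A := {
  cmul : A -> A -> A;
  cstar : A -> A;
  cmulA : associative cmul;
  cmulDl : forall x y z, cmul (x + y) z = cmul x z + cmul y z;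
  cmulDr : forall x y z, cmul x (y + z) = cmul x y + cmul x z;
  cmulZl : forall (c : R[i]) x y, cmul (c *: x) y = c *: cmul x y;
  cmulZr : forall (c : R[i]) x y, cmul x (c *: y) = c *: cmul x y;
  cstarD : forall x y, cstar (x + y) = cstar x + cstar y;
  cstarZ : forall (c : R[i]) x, cstar (c *: x) = (c^*)%R *: cstar x;
  cstarM : forall x y, cstar (cmul x y) = cmul (cstar y) (cstar x);
  cstarK : involutive cstar;
  cnormM_le : forall x y, `|cmul x y| <= `|x| * `|y|;
  cnorm_star_mul : forall x, `|cmul (cstar x) x| = `|x| ^+ 2
}.

#[short(type="cstarAlgType")]
HB.structure Definition CStarAlgebra (R : realType) :=
  {A of isCStarAlgebra R A & CompleteNormedModule R[i] A}.

Section CStarTheory.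
Context (R : realType) (A : cstarAlgType R).
Implicit Types x y z t : A.

Lemma cmul0l x : cmul 0 x = 0.
Proof. by rewrite -[X in cmul X _](scale0r 0) cmulZl scale0r. Qed.

Lemma cmul0r x : cmul x 0 = 0.
Proof. by rewrite -[X in cmul _ X](scale0r 0) cmulZr scale0r. Qed.

Lemma cmulNl x y : cmul (- x) y = - cmul x y.
Proof. by rewrite -scaleN1r cmulZl scaleN1r. Qed.

Lemma cmulNr x y : cmul x (- y) = - cmul x y.
Proof. by rewrite -scaleN1r cmulZr scaleN1r. Qed.

Lemma cmul_subE x y z t :
  cmul x y - cmul z t = cmul x (y - t) + cmul (x - z) t.
Proof. by rewrite cmulDr cmulDl cmulNr cmulNl addrA subrK. Qed.

End CStarTheory.

(* Right Hilbert D-modules, the inner product being linear in its second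
   argument. *)
HB.mixin Record isHilbertModule (R : realType) (D : cstarAlgType R) Y
    of CompleteNormedModule R[i] Y := {
  hact : Y -> D -> Y;
  hinner : Y -> Y -> D;
  hactDl : forall x y d, hact (x + y) d = hact x d + hact y d;
  hactDr : forall x d e, hact x (d + e) = hact x d + hact x e;
  hactZl : forall (c : R[i]) x d, hact (c *: x) d = c *: hact x d;
  hactZr : forall (c : R[i]) x d, hact x (c *: d) = c *: hact x d;
  hactM : forall x d e, hact x (cmul d e) = hact (hact x d) e;
  hinnerDr : forall x y z, hinner x (y + z) = hinner x y + hinner x z;
  hinnerZr : forall (c : R[i]) x y, hinner x (c *: y) = c *: hinner x y;
  hinner_act : forall x y d, hinner x (hact y d) = cmul (hinner x y) d;
  hinner_star : forall x y, cstar (hinner x y) = hinner y x;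
  hinner_pos : forall x, exists d, hinner x x = cmul (cstar d) d;
  hnormE : forall x, `|x| ^+ 2 = `|hinner x x|
}.

#[short(type="hilbertModType")]
HB.structure Definition HilbertModule (R : realType) (D : cstarAlgType R) :=
  {Y of isHilbertModule R D Y & CompleteNormedModule R[i] Y}.

Definition lspan (K : pzRingType) (V : lmodType K) (S : set V) : set V :=
  [set v | exists n (c : 'I_n -> K) (s : 'I_n -> V),
     (forall i, S (s i)) /\ v = \sum_(i < n) c i *: s i].

Section HilbertModules.
Context (R : realType) (D : cstarAlgType R) (Y : hilbertModType D).

Definition rank_one (y y' : Y) : Y -> Y := fun z => hact y (hinner y' z).

(* Membership in K(Y): approximation in operator norm by the linear span of
   the [rank_one y y']. *)
Definition compact_endo (b : Y -> Y) : Prop :=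
  forall e : R, 0 < e ->
    exists2 F : Y -> Y, lspan [set rank_one y y' | y in setT & y' in setT] F &
      forall z, `|b z - F z| <= e%:C * `|z|.

Definition self_adjoint (b : Y -> Y) : Prop :=
  forall x y, hinner (b x) y = hinner x (b y).

Definition closed_submodule (X : set Y) : Prop :=
  [/\ X 0, forall (c : R[i]) x y, X x -> X y -> X (c *: x + y),
      forall x d, X x -> X (hact x d) & closed X].

(* X is the closed submodule generated by a countable set. *)
Definition countably_generated (X : set Y) : Prop :=
  closed_submodule X /\
  exists S : set Y, [/\ countable S, S `<=` X &
    forall Z, closed_submodule Z -> S `<=` Z -> X `<=` Z].

(* X ⊂⊂ Y. *)
Definition compactly_contained (X : set Y) : Prop :=
  [/\ countably_generated X, countably_generated [set: Y] &
      exists b, [/\ compact_endo b, self_adjoint b & {in X, b =1 id}]].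

End HilbertModules.

Section Ideals.
Context (R : realType) (D : cstarAlgType R).

Record closed_ideal := ClosedIdeal {
  ideal_set :> set D;
  ideal0 : ideal_set 0;
  idealP : forall (c : R[i]) x y,
    ideal_set x -> ideal_set y -> ideal_set (c *: x + y);
  idealMl : forall d x, ideal_set x -> ideal_set (cmul d x);
  idealMr : forall d x, ideal_set x -> ideal_set (cmul x d);
  ideal_closed : closed ideal_set }.

Definition ideal_module (J : closed_ideal) : Type :=
  {x : D | x \in ideal_set J}.

Section IdealModule.
Context (J : closed_ideal).

HB.instance Definition _ := [isSub of ideal_module J for @sval _ _].
HB.instance Definition _ := [Choice of ideal_module J by <:].

Fact ideal_submod : submod_closed (mem (ideal_set J)).
Proof.
split; first by apply/mem_set/ideal0.
by move=> c x y /set_mem Jx /set_mem Jy; apply/mem_set/idealP.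
Qed.

HB.instance Definition _ :=
  GRing.SubChoice_isSubLmodule.Build R[i] D _ (ideal_module J) ideal_submod.

Let inorm (x : ideal_module J) : R[i] := `|\val x|.

Fact inormD x y : inorm (x + y) <= inorm x + inorm y.
Proof. by rewrite /inorm raddfD ler_normD. Qed.

Fact inormZ (c : R[i]) x : inorm (c *: x) = `|c| * inorm x.
Proof. by rewrite /inorm linearZ normrZ. Qed.

Fact inorm_eq0 x : inorm x = 0 -> x = 0.
Proof. by move/eqP; rewrite normr_eq0 => /eqP x0; exact: val_inj. Qed.

HB.instance Definition _ :=
  Lmodule_isNormed.Build R[i] (ideal_module J) inormD inormZ inorm_eq0.

Lemma ideal_normE (x : ideal_module J) : `|x| = `|\val x|.
Proof. by []. Qed.

Fact ideal_complete (F : set_system (ideal_module J)) :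
  ProperFilter F -> cauchy F -> cvg F.
Proof.
move=> FF cF.
have vE (x : ideal_module J) e (y : ideal_module J) :
  ball x e y = ball (\val x) e (\val y).
  by rewrite -!ball_normE /= ideal_normE raddfB.
have /cauchy_cvgP/cvg_ex[/= l Fl] :
    cauchy ((fun x : ideal_module J => \val x) @ F).
  apply/cauchy_ballP => e e0; move/cauchy_ballP : cF => /(_ _ e0) cF.
  rewrite near_map2; apply: filterS cF => -[x y]/=.
  by rewrite vE.
have Jl : l \in ideal_set J.
  apply/mem_set.
  apply: (@closed_cvg _ _ F _ (fun x : ideal_module J => \val x)) Fl => //.
    exact: ideal_closed.
  by near=> x; apply/set_mem/(valP x).
apply/cvg_ex; exists (Sub l Jl).
apply/cvg_ballP => e e0; near=> x.
rewrite vE SubK; near: x; move: e e0; exact/cvg_ballP.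
Unshelve. all: by end_near. Qed.

HB.instance Definition _ :=
  Uniform_isComplete.Build (ideal_module J) ideal_complete.

Definition ideal_act (x : ideal_module J) (d : D) : ideal_module J :=
  Sub (cmul (\val x) d) (mem_set (idealMr d (set_mem (valP x)))).

Definition ideal_inner (x y : ideal_module J) : D :=
  cmul (cstar (\val x)) (\val y).

Fact ideal_actDl x y d : ideal_act (x + y) d = ideal_act x d + ideal_act y d.
Proof. by apply: val_inj; exact: (cmulDl (\val x)). Qed.
Fact ideal_actDr x d e : ideal_act x (d + e) = ideal_act x d + ideal_act x e.
Proof. by apply: val_inj; exact: (cmulDr (\val x)). Qed.
Fact ideal_actZl (c : R[i]) x d : ideal_act (c *: x) d = c *: ideal_act x d.
Proof. by apply: val_inj; exact: (cmulZl c (\val x)). Qed.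
Fact ideal_actZr (c : R[i]) x d : ideal_act x (c *: d) = c *: ideal_act x d.
Proof. by apply: val_inj; exact: (cmulZr c (\val x)). Qed.
Fact ideal_actM x d e : ideal_act x (cmul d e) = ideal_act (ideal_act x d) e.
Proof. by apply: val_inj; exact: (cmulA (\val x)). Qed.
Fact ideal_innerDr x y z :
  ideal_inner x (y + z) = ideal_inner x y + ideal_inner x z.
Proof. exact: cmulDr. Qed.
Fact ideal_innerZr (c : R[i]) x y :
  ideal_inner x (c *: y) = c *: ideal_inner x y.
Proof. exact: cmulZr. Qed.
Fact ideal_inner_act x y d :
  ideal_inner x (ideal_act y d) = cmul (ideal_inner x y) d.
Proof. exact: cmulA. Qed.
Fact ideal_inner_star x y : cstar (ideal_inner x y) = ideal_inner y x.
Proof. by rewrite /ideal_inner cstarM cstarK. Qed.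
Fact ideal_inner_pos x : exists d, ideal_inner x x = cmul (cstar d) d.
Proof. by exists (\val x). Qed.
Fact ideal_hnormE (x : ideal_module J) : `|x| ^+ 2 = `|ideal_inner x x|.
Proof. by rewrite cnorm_star_mul. Qed.

HB.instance Definition _ := isHilbertModule.Build R D (ideal_module J)
  ideal_actDl ideal_actDr ideal_actZl ideal_actZr ideal_actM
  ideal_innerDr ideal_innerZr ideal_inner_act ideal_inner_star ideal_inner_pos
  ideal_hnormE.

End IdealModule.

(* [compactly_contained] for I, seen as a submodule of the Hilbert module J. *)
Definition ideal_compactly_contained (I J : closed_ideal) : Prop :=
  I `<=` J /\
  compactly_contained [set x : ideal_module J | ideal_set I (\val x)].

End Ideals.

HB.mixin Record isCompactHausdorff T of Topological T := {
  compactT : compact [set: T];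
  hausdorffT : hausdorff_space T
}.

#[short(type="compactHausdorffType")]
HB.structure Definition CompactHausdorff :=
  {T of isCompactHausdorff T & Topological T}.

Section ProductCompactHausdorff.
Context (K L : compactHausdorffType).

Fact prod_compactT : compact [set: K * L].
Proof. by rewrite -setXTT; apply: compact_setX; exact: compactT. Qed.

Fact prod_hausdorffT : hausdorff_space (K * L)%type.
Proof.
move=> [x y] [x' y'] cl; congr (_, _).
  apply: hausdorffT => A B xA x'B.
  have [||[a b] [/= Aa Ba]] := cl (A `*` setT) (B `*` setT).
  - by exists (A, setT) => //; split => //; exact: filterT.
  - by exists (B, setT) => //; split => //; exact: filterT.
  by exists a; split; [case: Aa|case: Ba].
apply: hausdorffT => A B yA y'B.
have [||[a b] [/= Ab Bb]] := cl (setT `*` A) (setT `*` B).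
- by exists (setT, A) => //; split => //; exact: filterT.
- by exists (setT, B) => //; split => //; exact: filterT.
by exists b; split; [case: Ab|case: Bb].
Qed.

HB.instance Definition _ :=
  isCompactHausdorff.Build (K * L)%type prod_compactT prod_hausdorffT.

End ProductCompactHausdorff.

Section ComplexNumbers.
Context (R : realType).
Implicit Types z w : R[i].

Lemma Re_normE z : (complex.Re `|z|)%:C = `|z|.
Proof. by rewrite normc_def. Qed.

Lemma Re_norm_sub z w :
  `|complex.Re z - complex.Re w| <= complex.Re `|z - w|.
Proof. by have := normc_ge_Re (z - w); rewrite -Re_normE lecR; case: z w => [a b] [c d]. Qed.

Lemma Im_norm_sub z w :
  `|complex.Im z - complex.Im w| <= complex.Re `|z - w|.
Proof.
have : `|complex.Im (z - w)|%:C <= `|z - w|.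
  rewrite normc_def lecR -sqrtr_sqr ler_wsqrtr// lerDr sqr_ge0//.
by rewrite -Re_normE lecR; case: z w => [a b] [c d].
Qed.

Lemma norm_le_ReIm z : complex.Re `|z| <= `|complex.Re z| + `|complex.Im z|.
Proof.
rewrite normc_def /= -[leRHS]ger0_norm ?addr_ge0// -sqrtr_sqr ler_wsqrtr//.
by rewrite sqrrD !real_normK ?num_real// lerD2r lerDl mulrn_wge0 ?mulr_ge0.
Qed.

Lemma gt0_complexE (e : R[i]) : 0 < e -> exists2 r : R, 0 < r & e = r%:C.
Proof.
case: e => a b; rewrite ltcE /= => /andP[/eqP b0 a0].
by exists a; rewrite ?b0.
Qed.

Lemma Re_continuous : continuous (@complex.Re R : R[i]^o -> R).
Proof.
move=> z; apply/(@cvgrPdist_le _ _ _ (nbhs z) (nbhs_filter z)) => e e0.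
have e0' : 0 < e%:C :> R[i] by rewrite ltcR.
apply: filterS (nbhsx_ballx (z : R[i]^o) _ e0') => w.
rewrite -ball_normE /= => /ltW zw; rewrite (le_trans (Re_norm_sub _ _))//.
by rewrite -lecR Re_normE.
Qed.

Fact complex_complete (F : set_system R[i]^o) :
  ProperFilter F -> cauchy F -> cvg F.
Proof.
move=> FF /cauchy_ballP cF.
have cvgF (g : R[i]^o -> R) :
    (forall z w, `|g z - g w| <= complex.Re `|z - w|) -> cvg (g @ F).
  move=> gL; apply/cauchy_cvgP/cauchy_ballP => e e0.
  have e0' : 0 < e%:C :> R[i] by rewrite ltcR.
  rewrite near_map2; apply: filterS (cF _ e0') => -[z w] /=.
  rewrite -!ball_normE /= => zw; rewrite (le_lt_trans (gL _ _))//.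
  by rewrite -ltcR Re_normE.
have /cvg_ex[/= a Fa] := cvgF (@complex.Re R) Re_norm_sub.
have /cvg_ex[/= b Fb] := cvgF (@complex.Im R) Im_norm_sub.
apply/cvg_ex; exists (a +i* b); apply/cvgrPdist_le => _ /gt0_complexE[e e0 ->].
have e20 : 0 < e / 2 by rewrite divr_gt0.
near=> z; rewrite -Re_normE lecR (le_trans (norm_le_ReIm _))// [e]splitr.
have -> : complex.Re ((a +i* b) - z) = a - complex.Re z by case: (z).
have -> : complex.Im ((a +i* b) - z) = b - complex.Im z by case: (z).
by apply: lerD; near: z; move: (e / 2) e20; apply/cvgrPdist_le.
Unshelve. all: by end_near. Qed.

End ComplexNumbers.

(* The carrier of C(K).  The copy R[i]^o of the complex numbers is the one on
   which the library puts the topology of the modulus. *)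
Record cfun (R : realType) (K : compactHausdorffType) := CFun {
  cfun_fun :> K -> R[i]^o;
  cfun_cts : `[< continuous cfun_fun >] }.

Section ContinuousFunctions.
Context (R : realType) (K : compactHausdorffType).
Local Notation "'CK'" := (cfun R K).
Local Notation C := (R[i]^o).

HB.instance Definition _ := [isSub for @cfun_fun R K].
HB.instance Definition _ := [Choice of CK by <:].

Lemma cfunP (f g : CK) : f =1 g -> f = g.
Proof. by move=> fg; apply: val_inj; exact/funext. Qed.

Lemma cfun_continuous (f : CK) : continuous f.
Proof. exact/asboolP/cfun_cts. Qed.

Definition mk_cfun (f : K -> C) (fc : continuous f) : CK := CFun (asboolT fc).

Let cfun_pred : {pred K -> C} := fun f => `[< continuous f >].

Fact cfun_submod : submod_closed cfun_pred.
Proof.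
split.
  by apply: asboolT => x; exact: cvg_cst.
move=> c f g fc0 gc0.
have fc : continuous f := asboolW fc0.
have gc : continuous g := asboolW gc0.
apply: asboolT => x.
by apply: cvgD; [apply: cvgZr; exact: fc | exact: gc].
Qed.

HB.instance Definition _ :=
  GRing.SubChoice_isSubLmodule.Build R[i] (K -> C) _ CK cfun_submod.

Definition sup_norm (f : CK) : R[i] :=
  (sup [set complex.Re `|f x| | x in [set: K]])%:C.

Fact sup_norm_ub (f : CK) :
  has_ubound [set complex.Re `|f x| | x in [set: K]].
Proof.
have fc : continuous (fun x => complex.Re `|f x|).
  move=> x.
  apply: (@continuous_comp _ _ _ (fun x => `|f x| : C) (@complex.Re R)).
    apply: (@continuous_comp _ _ _ (f : K -> C) (fun z : C => `|z| : C)).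
      exact: cfun_continuous.
    exact: norm_continuous.
  exact: Re_continuous.
have : compact ((fun x => complex.Re `|f x|) @` [set: K]).
  apply: continuous_compact; last exact: compactT.
  exact: continuous_subspaceT.
move/compact_bounded => [M [_ MA]]; exists (M + 1) => y Ay.
by rewrite (le_trans (ler_norm _))// (MA (M + 1)) ?ltrDl.
Qed.

Lemma sup_norm_ge (f : CK) x : `|f x| <= sup_norm f.
Proof.
rewrite -Re_normE lecR; apply: ub_le_sup; first exact: sup_norm_ub.
by exists x.
Qed.

Lemma sup_norm_le (f : CK) (M : R[i]) :
  0 <= M -> (forall x, `|f x| <= M) -> sup_norm f <= M.
Proof.
move=> M0 fM; have ME : M = (complex.Re M)%:C by rewrite -{1}(ger0_norm M0) normc_def -[in RHS](ger0_norm M0) normc_def.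
rewrite ME lecR.
have [[y [x _ _]]|/set0P/negP/negPn/eqP ->] :=
  pselect ([set complex.Re `|f x| | x in [set: K]] !=set0).
  apply: ge_sup; first by exists (complex.Re `|f x|), x.
  by move=> _ [z _ <-]; rewrite -lecR Re_normE -ME.
by rewrite sup0 -lecR -ME.
Qed.

Lemma sup_norm_ge0 f : 0 <= sup_norm f.
Proof.
rewrite lecR; set A := (X in sup X).
have [->|/set0P[_ [x _ _]]] := eqVneq A set0; first by rewrite sup0.
rewrite -lecR; apply: le_trans (sup_norm_ge f x); exact: normr_ge0.
Qed.

Fact sup_normD f g : sup_norm (f + g) <= sup_norm f + sup_norm g.
Proof.
apply: sup_norm_le => [|x]; first by rewrite addr_ge0 ?sup_norm_ge0.
by rewrite (le_trans (ler_normD (f x) (g x)))// lerD ?sup_norm_ge.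
Qed.

Let sup_normZ_le (c : R[i]) f : sup_norm (c *: f) <= `|c| * sup_norm f.
Proof.
apply: sup_norm_le => [|x]; first by rewrite mulr_ge0 ?sup_norm_ge0.
by rewrite [X in X <= _](normrM c (f x)) ler_wpM2l ?sup_norm_ge.
Qed.

Fact sup_normZ (c : R[i]) f : sup_norm (c *: f) = `|c| * sup_norm f.
Proof.
apply/le_anti; rewrite sup_normZ_le /=.
have [->|c0] := eqVneq c 0; first by rewrite normr0 mul0r sup_norm_ge0.
have c0' : 0 < `|c| by rewrite normr_gt0.
rewrite -ler_pdivlMl// -normfV (le_trans _ (sup_normZ_le _ _))//.
by rewrite scalerA mulVf// scale1r.
Qed.

Fact sup_norm_eq0 f : sup_norm f = 0 -> f = 0.
Proof.
move=> f0; apply: cfunP => x; apply/eqP; rewrite -normr_le0.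
by have := sup_norm_ge f x; rewrite f0.
Qed.

HB.instance Definition _ := Lmodule_isNormed.Build R[i] CK
  sup_normD sup_normZ sup_norm_eq0.

Lemma cfun_norm_ge (f : CK) x : `|f x| <= `|f|.
Proof. exact: sup_norm_ge. Qed.

Lemma cfun_norm_le (f : CK) (M : R[i]) :
  0 <= M -> (forall x, `|f x| <= M) -> `|f| <= M.
Proof. exact: sup_norm_le. Qed.

Fact cfun_complete (F : set_system CK) : ProperFilter F -> cauchy F -> cvg F.
Proof.
move=> FF /cauchy_ballP cF.
have ptw x : cvg ((fun f : CK => f x : C) @ F).
  apply: complex_complete; apply/cauchy_ballP => e e0.
  rewrite near_map2; apply: filterS (cF _ e0) => -[f g] /=.
  rewrite -!ball_normE /=; apply: le_lt_trans.
  exact: (cfun_norm_ge (f - g)).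
pose l x : C := lim ((fun f : CK => f x : C) @ F).
have lE x : (fun f : CK => f x : C) @ F --> l x by exact: ptw.
have unif (e : R[i]) : 0 < e -> F [set f : CK | forall x, `|l x - f x| <= e].
  move=> e0; have e20 : 0 < e / 2%:R by rewrite divr_gt0.
  have [[A B] /= [FA FB] AB] := cF _ e20.
  apply: filterS FB => f Bf x.
  have /filter_ex[g [Ag lg]] :
      F (A `&` [set g : CK | `|l x - g x| <= e / 2%:R]).
    by apply: filterI => //; move: (e / 2%:R) e20; apply/cvgrPdist_le/lE.
  rewrite [e]splitr (le_trans (ler_distD (g x) _ _))// lerD//.
  have := AB (g, f) (conj Ag Bf); rewrite -ball_normE /= => /ltW.
  by apply: le_trans; exact: (cfun_norm_ge (g - f)).
have lc : continuous l.
  move=> x; apply/cvgrPdist_le => e e0.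
  have e30 : 0 < e / 3%:R by rewrite divr_gt0.
  have /filter_ex[f fl] := unif _ e30.
  near=> y.
  have -> : l x - l y = (l x - f x) + (f x - f y) + (f y - l y).
    by rewrite !subrKA.
  have -> : e = e / 3%:R + e / 3%:R + e / 3%:R.
    by rewrite -[LHS](@divfK _ 3%:R) ?pnatr_eq0// mulr_natr !mulrSr mulr0n add0r.
  rewrite (le_trans (ler_normD _ _))// lerD//; last by rewrite distrC.
  rewrite (le_trans (ler_normD _ _))// lerD//.
  near: y; move: (e / 3%:R) e30; apply/cvgrPdist_le; exact: cfun_continuous.
apply/cvg_ex; exists (mk_cfun lc); apply/cvgrPdist_le => e e0.
apply: filterS (unif _ e0) => f lf.
by apply: cfun_norm_le; [exact: ltW | exact: lf].
Unshelve. all: by end_near. Qed.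

HB.instance Definition _ := Uniform_isComplete.Build CK cfun_complete.

Fact cfun_mul_cts (f g : CK) : continuous (fun x => f x * g x : C).
Proof. by move=> x; apply: cvgM; exact: cfun_continuous. Qed.

Definition cfun_mul (f g : CK) : CK := mk_cfun (@cfun_mul_cts f g).

Fact cfun_conj_cts (f : CK) : continuous (fun x => (f x)^* : C)%R.
Proof.
move=> x; apply/cvgrPdist_le => e e0; near=> y.
rewrite -rmorphB norm_conjC; near: y; move: e e0; apply/cvgrPdist_le.
exact: cfun_continuous.
Unshelve. all: by end_near. Qed.

Definition cfun_conj (f : CK) : CK := mk_cfun (@cfun_conj_cts f).

Fact cfun_mulA : associative cfun_mul.
Proof. by move=> f g h; apply: cfunP => x /=; rewrite mulrA. Qed.
Fact cfun_mulDl f g h : cfun_mul (f + g) h = cfun_mul f h + cfun_mul g h.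
Proof. by apply: cfunP => x; exact: mulrDl. Qed.
Fact cfun_mulDr f g h : cfun_mul f (g + h) = cfun_mul f g + cfun_mul f h.
Proof. by apply: cfunP => x; exact: mulrDr. Qed.
Fact cfun_mulZl (c : R[i]) f g : cfun_mul (c *: f) g = c *: cfun_mul f g.
Proof. by apply: cfunP => x; rewrite /= -[LHS]/(c * f x * g x) -mulrA. Qed.
Fact cfun_mulZr (c : R[i]) f g : cfun_mul f (c *: g) = c *: cfun_mul f g.
Proof. by apply: cfunP => x; rewrite /= -[LHS]/(f x * (c * g x)) mulrCA. Qed.
Fact cfun_conjD f g : cfun_conj (f + g) = cfun_conj f + cfun_conj g.
Proof.
apply: cfunP => x.
have E : ((f x + g x : R[i])^* = (f x : R[i])^* + (g x : R[i])^*)%R.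
  exact: rmorphD.
exact: E.
Qed.
Fact cfun_conjZ (c : R[i]) f : cfun_conj (c *: f) = (c^*)%R *: cfun_conj f.
Proof.
apply: cfunP => x.
have E : ((c * f x : R[i])^* = c^* * (f x : R[i])^*)%R by exact: rmorphM.
exact: E.
Qed.
Fact cfun_conjM f g :
  cfun_conj (cfun_mul f g) = cfun_mul (cfun_conj g) (cfun_conj f).
Proof. by apply: cfunP => x; rewrite /= rmorphM mulrC. Qed.
Fact cfun_conjK : involutive cfun_conj.
Proof. by move=> f; apply: cfunP => x; exact: conjCK. Qed.
Fact cfun_normM_le (f g : CK) : `|cfun_mul f g| <= `|f| * `|g|.
Proof.
apply: cfun_norm_le => [|x]; first by rewrite mulr_ge0.
by rewrite /= normrM ler_pM ?cfun_norm_ge.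
Qed.
Fact cfun_norm_star_mul (f : CK) : `|cfun_mul (cfun_conj f) f| = `|f| ^+ 2.
Proof.
apply/le_anti/andP; split.
  rewrite (le_trans (cfun_normM_le _ _))// expr2 ler_wpM2r//.
  by apply: cfun_norm_le => // x; rewrite /= norm_conjC cfun_norm_ge.
have -> : `|cfun_mul (cfun_conj f) f| = sqrtC `|cfun_mul (cfun_conj f) f| ^+ 2.
  by rewrite sqrtCK.
rewrite ler_pXn2r ?nnegrE ?sqrtC_ge0//.
apply: cfun_norm_le => [|x]; first by rewrite sqrtC_ge0.
rewrite -(@ler_pXn2r _ 2) ?nnegrE ?sqrtC_ge0// sqrtCK.
by have := cfun_norm_ge (cfun_mul (cfun_conj f) f) x; rewrite /= normrM norm_conjC -expr2.
Qed.

HB.instance Definition _ := isCStarAlgebra.Build R CK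
  cfun_mulA cfun_mulDl cfun_mulDr cfun_mulZl cfun_mulZr
  cfun_conjD cfun_conjZ cfun_conjM cfun_conjK cfun_normM_le cfun_norm_star_mul.

End ContinuousFunctions.

Section LinearSpan.
Context (R : realType) (V : normedModType R[i]).
Implicit Types (S T : set V) (c : R[i]).

Lemma lspan_sub S : S `<=` lspan S.
Proof.
move=> v Sv; exists 1%N, (fun=> 1), (fun=> v); split => //.
by rewrite big_ord1 scale1r.
Qed.

Lemma lspan0 S : lspan S 0.
Proof.
exists 0%N, (fun=> 0), (fun=> 0); split; first by case.
by rewrite big_ord0.
Qed.

Lemma lspanP S c u v : lspan S u -> lspan S v -> lspan S (c *: u + v).
Proof.
move=> [n [a [s [Ss ->]]]] [m [b [t [St ->]]]].
exists (n + m)%N,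
  (fun i : 'I_(n + m) => match fintype.split i with inl j => c * a j | inr j => b j end),
  (fun i : 'I_(n + m) => match fintype.split i with inl j => s j | inr j => t j end).
split.
  by move=> i; case: (fintype.split i).
rewrite big_split_ord scaler_sumr; congr (_ + _); apply: eq_bigr => i _.
  by rewrite (unsplitK (inl _ i)) scalerA.
by rewrite (unsplitK (inr _ i)).
Qed.

Lemma lspan_min S T : T 0 ->
  (forall c u v, T u -> T v -> T (c *: u + v)) -> S `<=` T -> lspan S `<=` T.
Proof.
move=> T0 TP ST _ [n [a [s [Ss ->]]]].
elim/big_ind : _ => // [u v Tu Tv|i _].
  by rewrite -[u]scale1r; exact: TP.
by rewrite -[_ *: _]addr0; apply: TP => //; exact: ST.
Qed.

Lemma closure_normP S x :
  closure S x <-> forall e : R[i], 0 < e -> exists2 s, S s & `|x - s| < e.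
Proof.
split => [Sx e e0|Sx B].
  have [s [Ss]] := Sx _ (nbhsx_ballx x _ e0).
  by rewrite -ball_normE /=; exists s.
move=> /nbhs_ballP[e /= e0 eB]; have [s Ss xs] := Sx _ e0.
by exists s; split => //; apply: eB; rewrite -ball_normE.
Qed.

Lemma closure_linear S : (forall c u v, S u -> S v -> S (c *: u + v)) ->
  forall c u v, closure S u -> closure S v -> closure S (c *: u + v).
Proof.
move=> SP c u v /closure_normP Su /closure_normP Sv; apply/closure_normP => e e0.
have c0 : 0 < `|c| + 1 by rewrite ltr_wpDl.
have e20 : 0 < e / 2%:R by rewrite divr_gt0.
have [s Ss us] := Su _ (divr_gt0 e20 c0).
have [t St vt] := Sv _ e20.
exists (c *: s + t); first exact: SP.
rewrite opprD addrACA -scalerBr [e]splitr (le_lt_trans (ler_normD _ _))//.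
rewrite ler_ltD// normrZ (@le_trans _ _ ((`|c| + 1) * `|u - s|))//.
  by rewrite ler_wpM2r// lerDl.
by rewrite mulrC -ler_pdivlMr// ltW.
Qed.

End LinearSpan.

Lemma real_complex_continuous (R : realType) :
  continuous (fun r : R => r%:C : R[i]^o).
Proof.
move=> r; apply/cvgrPdist_le => _ /gt0_complexE[e e0 ->].
near=> s.
rewrite -[X in `|X|]/(r%:C - s%:C) -raddfB normc_def /= expr0n addr0 sqrtr_sqr lecR.
near: s; move: e e0; apply/cvgrPdist_le; exact: cvg_id.
Unshelve. all: by end_near. Qed.

Section Tensor.
Context (R : realType) (K L : compactHausdorffType).
Local Notation C := (R[i]^o).

Fact tens_cts (f : cfun R K) (g : cfun R L) :
  continuous (fun p : K * L => f p.1 * g p.2 : C).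
Proof.
move=> [x y]; apply: (@cvgM _ _ _ _ (fun p => f p.1 : C) (fun p => g p.2 : C)).
  apply: (@continuous_comp _ _ _ (@fst K L) (f : K -> C)); first exact: cvg_fst.
  exact: cfun_continuous.
apply: (@continuous_comp _ _ _ (@snd K L) (g : L -> C)); first exact: cvg_snd.
exact: cfun_continuous.
Qed.

Definition tens (f : cfun R K) (g : cfun R L) : cfun R (K * L)%type :=
  mk_cfun (@tens_cts f g).

(* The C*-tensor product C(K) ⊗ C(L) is identified with C(K * L), [tens f g]
   being the elementary tensor of f and g; the tensor product of two closed
   ideals is then the closed linear span of its elementary tensors.  Lemma
   [tensor_setTT] below says that C(K) ⊗ C(L) is indeed all of C(K * L). *)
Definition tensor_set (A : set (cfun R K)) (B : set (cfun R L)) :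
    set (cfun R (K * L)%type) :=
  closure (lspan [set tens f g | f in A & g in B]).

Lemma partition_of_unity (P : K -> K -> Prop) :
  (forall x, \forall x' \near x, P x x') ->
  exists s : seq K, exists psi : K -> cfun R K,
    [/\ forall i x, 0 <= psi i x :> R[i],
        forall x, \sum_(i <- s) (psi i x : R[i]) = 1 &
        forall i x, psi i x != 0 :> R[i] -> P i x].
Proof.
move=> nearP.
have /choice[phi phiP] (i : K) : exists phi : K -> R,
    [/\ continuous phi, forall x, 0 <= phi x, phi i = 1 &
        forall x, phi x != 0 -> P i x].
  have Ni := nearP i.
  have : uniform_separator (~` [set x | P i x]°) [set i].
    apply: (@normal_separatorP R K).1.
    - exact: compact_normal (@hausdorffT K) (@compactT K).
    - by apply: open_closedC; exact: open_interior.
    - apply: accessible_closed_set1; apply: hausdorff_accessible.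
      exact: hausdorffT.
    - by rewrite -subset0 => x [/= nx xi]; apply: nx; rewrite xi.
  move=> /(@uniform_separatorP _ R)[phi [phic phi01 phi0 phi1]].
  exists phi; split => //.
  - move=> x; have : range phi (phi x) by exists x.
    by move/phi01; rewrite /= in_itv /= => /andP[].
  - by apply: phi1; exists i.
  - move=> x phix; apply: contrapT => nPx; move/eqP: phix; apply.
    by apply: phi0; exists x => //= /interior_subset.
pose F : set_system (seq K) :=
  filter_from setT (fun s : seq K => [set t : seq K | {subset s <= t}]).
have FF : Filter F.
  apply: filter_from_filter; first by exists [::].
  move=> s t _ _; exists (s ++ t) => // u su; split => x xs; apply: su.
    by rewrite mem_cat xs.
  by rewrite mem_cat xs orbT.
have : compact [set: K] by exact: compactT.
move/compact_near_coveringP.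
move=> /(_ (seq K) F (fun s x => exists2 i, i \in s & 0 < phi i x) FF)[].
  move=> x _; have [phic phi_ge0 phix _] := phiP x.
  have N : \forall x' \near x, 0 < phi x x'.
    by have := cvgr_gt _ (phic x); apply; rewrite phix.
  exists ([set x' | 0 < phi x x'], [set t : seq K | {subset [:: x] <= t}]).
    by split => //; exists [:: x].
  move=> [x' t] /= [xx' xt]; exists x => //.
  by apply: xt; rewrite mem_seq1.
move=> s _ /(_ s) sP.
pose Sig x := \sum_(i <- s) phi i x.
have Sig0 x : 0 < Sig x.
  have [//|i si ix] := sP _ x I.
  by rewrite /Sig (big_rem i)//= ltr_wpDr// sumr_ge0// => j _; have [] := phiP j.
have Sigc : continuous Sig.
  rewrite /Sig; elim: (s) => [|i t IH].
    rewrite (_ : (fun x => _) = cst 0); first by move=> x; exact: cvg_cst.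
    by apply/funext => x; rewrite big_nil.
  rewrite (_ : (fun x => _) = (fun x => phi i x + \sum_(j <- t) phi j x)).
    move=> x; apply: cvgD; last exact: IH.
    by have [phic _ _ _] := phiP i; exact: phic.
  by apply/funext => x; rewrite big_cons.
have psic i : continuous (fun x => (phi i x / Sig x)%:C : C).
  move=> x; apply: (@continuous_comp _ _ _ (fun x => phi i x / Sig x)
    (fun r : R => r%:C : C)); last exact: real_complex_continuous.
  apply: cvgM; first by have [phic _ _ _] := phiP i; exact: phic.
  by apply: cvgV; [rewrite gt_eqF|exact: Sigc].
exists s, (fun i => mk_cfun (psic i)); split.
- move=> i x; rewrite /= lecR divr_ge0 ?(ltW (Sig0 x))//.
  by have [] := phiP i.
- move=> x /=; rewrite -(raddf_sum (real_complex R)) -mulr_suml.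
  by rewrite -/(Sig x) divff// gt_eqF.
- move=> i x /= /eqP pix; have [_ _ _] := phiP i; apply.
  by apply: contra_notN pix => /eqP ->; rewrite mul0r.
Qed.

Lemma tens_dense (h : cfun R (K * L)%type) : tensor_set setT setT h.
Proof.
apply/closure_normP => _ /gt0_complexE[e e0 ->].
have e20 : 0 < (e / 2)%:C :> R[i] by rewrite ltcR divr_gt0.
pose P x x' := forall y, `|h (x', y) - h (x, y) : R[i]| <= (e / 2)%:C.
have [|s [psi [psi_ge0 psi1 psiP]]] := @partition_of_unity P.
  move=> x; have /compact_near_coveringP NC : compact [set: L].
    exact: compactT.
  suff : \forall x' \near x, [set: L] `<=`
      [set y | `|h (x', y) - h (x, y) : R[i]| <= (e / 2)%:C].
    by apply: filterS => x' xP y; exact: xP.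
  apply: (NC K (nbhs x) (fun x' y => `|h (x', y) - h (x, y) : R[i]| <= _)
    (nbhs_filter x)) => y _.
    have hc : continuous (fun p => h p : C) by exact: cfun_continuous.
    have e40 : 0 < (e / 2)%:C / 2%:R :> R[i] by rewrite divr_gt0.
    have := hc (x, y) _ (nbhsx_ballx (h (x, y) : C) _ e40).
    rewrite -ball_normE /= => -[[U V] /= [Ux Vy] UV].
    exists (V, U) => //= -[y' x'] /= [Vy' Ux'].
    have h1 := UV (x', y') (conj Ux' Vy').
    have h2 := UV (x, y') (conj (nbhs_singleton Ux) Vy').
    rewrite [leRHS]splitr (le_trans (ler_distD (h (x, y) : R[i]) _ _))//.
    by rewrite lerD// ltW// distrC.
have hcts i : continuous (fun y => h (i, y) : C).
  move=> y; apply: (@continuous_comp _ _ _ (fun y => (i, y)) (h : _ -> C)).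
    by apply: cvg_pair => //=; exact: cvg_cst.
  exact: cfun_continuous.
pose t := \sum_(i <- s) tens (psi i) (mk_cfun (hcts i)).
have tE p : t p = \sum_(i <- s) (psi i p.1 : R[i]) * h (i, p.2).
  rewrite /t; elim/big_rec2 : _ => // i u v _ <-.
  by [].
exists t.
  rewrite /t; elim/big_rec : _ => [|i u _ Su]; first exact: lspan0.
  rewrite -[tens _ _]scale1r; apply: lspanP => //; apply: lspan_sub.
  by exists (psi i) => //; exists (mk_cfun (hcts i)).
apply: (@le_lt_trans _ _ (e / 2)%:C); last first.
  by rewrite ltcR ltr_pdivrMr// ltr_pMr// ltr1n.
apply: cfun_norm_le => [|[x y]]; first exact: ltW.
have -> : (h - t) (x, y) = \sum_(i <- s) (psi i x : R[i]) * (h (x, y) - h (i, y)).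
  rewrite -[LHS]/((h (x, y) : R[i]) - t (x, y)) tE /=.
  under [RHS]eq_bigr do rewrite mulrBr.
  by rewrite sumrB -mulr_suml psi1 mul1r.
rewrite (le_trans (ler_norm_sum _ _ _))//.
rewrite -[leRHS]mul1r -(psi1 x) mulr_suml ler_sum// => i _.
rewrite normrM ger0_norm//.
have [->|pix] := eqVneq (psi i x : R[i]) 0; first by rewrite !mul0r.
by rewrite ler_wpM2l// psiP.
Qed.

Lemma tensor_setTT : tensor_set setT setT = setT.
Proof. by apply/seteqP; split => // h _; exact: tens_dense. Qed.

Context (I : closed_ideal (cfun R K)) (J : closed_ideal (cfun R L)).

Fact tensor_ideal0 : tensor_set I J 0.
Proof. by apply: subset_closure; exact: lspan0. Qed.

Fact tensor_idealP (c : R[i]) x y :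
  tensor_set I J x -> tensor_set I J y -> tensor_set I J (c *: x + y).
Proof. by apply: closure_linear; exact: lspanP. Qed.

Fact tensor_ideal_mul (h x : cfun R (K * L)%type) :
  tensor_set I J x -> tensor_set I J (cmul h x).
Proof.
have ts (t s : cfun R (K * L)%type) :
    lspan [set tens f g | f in setT & g in setT] t ->
    lspan [set tens f g | f in ideal_set I & g in ideal_set J] s ->
    lspan [set tens f g | f in ideal_set I & g in ideal_set J] (cmul t s).
  move=> tT sIJ; move: t tT; apply: lspan_min => [|c u v Tu Tv|].
  - by rewrite cmul0l; exact: lspan0.
  - by rewrite cmulDl cmulZl; exact: lspanP.
  - move=> _ [f _ [g _ <-]]; move: s sIJ; apply: lspan_min => [|c u v Tu Tv|].
    + by rewrite cmul0r; exact: lspan0.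
    + by rewrite cmulDr cmulZr; exact: lspanP.
    + move=> _ [f' If' [g' Jg' <-]]; apply: lspan_sub.
      exists (cmul f f'); first exact: idealMl.
      exists (cmul g g'); first exact: idealMl.
      by apply: cfunP => p /=; rewrite mulrACA.
move=> /closure_normP xIJ; apply/closure_normP => e e0.
have e20 : 0 < e / 2%:R by rewrite divr_gt0.
have h0 : 0 < `|h| + 1 by rewrite ltr_wpDl.
have [s sIJ xs] := xIJ _ (divr_gt0 e20 h0).
have s0 : 0 < `|s| + 1 by rewrite ltr_wpDl.
have /closure_normP hd := @tens_dense h.
have [t tT ht] := hd _ (divr_gt0 e20 s0).
exists (cmul t s); first exact: ts.
rewrite cmul_subE [e]splitr (le_lt_trans (ler_normD _ _))// ler_ltD//.
  rewrite (le_trans (cnormM_le _ _))// mulrC.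
  rewrite (@le_trans _ _ (`|x - s| * (`|h| + 1)))//.
    by rewrite ler_wpM2l// lerDl.
  by rewrite -ler_pdivlMr// ltW.
rewrite (le_lt_trans (cnormM_le _ _))//.
rewrite (@le_lt_trans _ _ (`|h - t| * (`|s| + 1)))//.
  by rewrite ler_wpM2l// lerDl.
by rewrite -ltr_pdivlMr.
Qed.

Fact tensor_idealMr (h x : cfun R (K * L)%type) :
  tensor_set I J x -> tensor_set I J (cmul x h).
Proof.
move=> xIJ; suff -> : cmul x h = cmul h x by exact: tensor_ideal_mul.
by apply: cfunP => p; exact: mulrC.
Qed.

Definition tensor_ideal : closed_ideal (cfun R (K * L)%type) :=
  ClosedIdeal tensor_ideal0 tensor_idealP tensor_ideal_mul tensor_idealMr
    (@closed_closure _ _).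

End Tensor.

(* Main.v *)
(** For commutative [C(K)], every element of the span of the rank-one operators
    on an ideal [J] is multiplication by a function [k] in [J].  If such an
    operator is at distance at most [1/2] from the identity on [I], then
    [|1 - k| <= 1/2], hence [|k| >= 1/2], at each point where some element of
    [I] does not vanish, and [g = |k|^2 / max(|k|^2, 1/4)] is a real element of
    [J] with [g x = x] for [x] in [I].  For [G = g1 \otimes g2], multiplication
    by [G^2] is the rank-one operator [rank_one G G], and it is the identity on
    [I1 \otimes I2]. *)

Require Import Defs.
From mathcomp Require Import all_boot all_order all_algebra.
From mathcomp Require Import boolp classical_sets functions cardinality reals.
From mathcomp Require Import topology normedtype.
From mathcomp Require Import complex.

Local Open Scope classical_set_scope.

Set Implicit Arguments.
Unset Strict Implicit.
Unset Printing Implicit Defensive.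
Import Order.TTheory GRing.Theory Num.Theory numFieldNormedType.Exports.
Local Open Scope ring_scope.
Local Open Scope complex_scope.

(** * Closed sets in normed modules and their Lipschitz preimages *)

Lemma closed_normP (R : realType) (V : normedModType R[i]) (Z : set V) :
  closed Z <->
  forall x, (forall e : R[i], 0 < e -> exists2 s, Z s & `|x - s| < e) -> Z x.
Proof.
split => Zc x; first by move/closure_normP; exact: Zc.
by move/closure_normP; exact: Zc.
Qed.

Lemma closed_preimage_lipschitz (R : realType) (V W : normedModType R[i])
    (phi : V -> W) (M : R[i]) (Z : set W) :
  0 <= M -> (forall x y, `|phi x - phi y| <= M * `|x - y|) ->
  closed Z -> closed (phi @^-1` Z).
Proof.
move=> M0 phiM /closed_normP Zc; apply/closed_normP => x xP; apply: Zc => e e0.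
(* Dividing by [M + 1] instead of [M] covers the case [M = 0]. *)
have M1 : 0 < M + 1 by rewrite ltr_wpDl.
have [s Zs xs] := xP _ (divr_gt0 e0 M1).
exists (phi s) => //; rewrite (le_lt_trans (phiM _ _))//.
rewrite (@le_lt_trans _ _ ((M + 1) * `|x - s|))//.
  by rewrite ler_wpM2r// lerDl.
by rewrite mulrC -ltr_pdivlMr.
Qed.

(** * Countable generation of ideals, expressed in the ambient algebra *)

Section Generators.
Context (R : realType) (D : cstarAlgType R).

(** The subsets of [D] that match closed submodules of an ideal module: [val] carries such
    submodules to these sets, and preimages under [val] go back. *)
Definition closed_right_ideal (Z : set D) : Prop :=
  [/\ Z 0, forall (c : R[i]) x y, Z x -> Z y -> Z (c *: x + y),
      forall x d, Z x -> Z (cmul x d) & closed Z].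

(** Generation is tested inside [D] because the hypotheses view [I] as a Hilbert module in its own
    right, while the conclusion views it as a submodule of [J]. *)
Definition ideal_generators (I : closed_ideal D) (S : set D) : Prop :=
  S `<=` I /\ forall Z, closed_right_ideal Z -> S `<=` Z -> I `<=` Z.

Lemma countably_generated_generators (I : closed_ideal D) :
  countably_generated [set: ideal_module I] ->
  exists2 S, countable S & ideal_generators I S.
Proof.
move=> [_ [S [Sc _ Sgen]]]; exists (val @` S).
  exact: sub_countable (card_image_le _ _) Sc.
split=> [_ [x _ <-]|Z [Z0 ZP ZM Zc] SZ x Ix]; first exact/set_mem/(valP x).
suff : [set: ideal_module I] `<=` val @^-1` Z.
  by move=> /(_ (Sub x (mem_set Ix)) Logic.I).
apply: Sgen; last by move=> y Sy; apply: SZ; exists y.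
split => [|c y z|y d|] //=.
- exact: ZP.
- exact: ZM.
(* The inclusion [val] is isometric, hence the constant 1. *)
- by apply: (@closed_preimage_lipschitz _ _ _ _ 1) => // y z; rewrite mul1r.
Qed.

(** Closedness survives the passage to [D] because [J] is closed there: a limit of elements of [Z]
    stays in [J], and [Z] is closed in [J]. *)
Lemma closed_right_ideal_image (J : closed_ideal D) (Z : set (ideal_module J)) :
  closed_submodule Z -> closed_right_ideal (val @` Z).
Proof.
move=> [Z0 ZP ZM /closed_normP Zc]; split.
- by exists 0.
- by move=> c _ _ [x Zx <-] [y Zy <-]; exists (c *: x + y) => //; exact: ZP.
- by move=> _ d [x Zx <-]; exists (hact x d) => //; exact: ZM.
- apply/closed_normP => x xZ.
  have Jx : ideal_set J x.
    move/closed_normP: (@ideal_closed _ _ J); apply => e /xZ[_ [s _ <-] xs].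
    by exists (val s) => //; exact/set_mem/(valP s).
  exists (Sub x (mem_set Jx)); last by rewrite SubK.
  by apply: Zc => e /xZ[_ [s Zs <-] xs]; exists s.
Qed.

Lemma generators_countably_generated (I J : closed_ideal D) (S : set D) :
  I `<=` J -> countable S -> ideal_generators I S ->
  countably_generated [set x : ideal_module J | ideal_set I (\val x)].
Proof.
move=> IJ Sc [SI Sgen]; split.
  split => [|c x y|x d|] /=.
  - exact: ideal0.
  - exact: idealP.
  - exact: Defs.idealMr.
  - apply: (@closed_preimage_lipschitz _ (ideal_module J) D val 1 I) => //.
      by move=> x y; rewrite mul1r.
    exact: ideal_closed.
exists (val @^-1` S); split.
- case/countable_injP: Sc => f f_inj; apply/countable_injP; exists (f \o val).
  move=> x y /set_mem Sx /set_mem Sy fxy; apply: val_inj.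
  by apply: f_inj fxy; exact/mem_set.
- by move=> x /SI.
- move=> Z Zm SZ x Ix.
  (* The image of [Z] is a closed right ideal of [D] containing [S], hence contains [I]; injectivity
     of [val] leads back to [Z]. *)
  suff [y Zy /val_inj<-] : (val @` Z) (\val x) by [].
  apply: Sgen Ix; first exact: closed_right_ideal_image.
  move=> s Ss; have Js := IJ _ (SI _ Ss).
  exists (Sub s (mem_set Js)); last by rewrite SubK.
  exact: SZ.
Qed.

End Generators.

(** * Elementary tensors and generators of tensor products of ideals *)

Section TensorGenerators.
Context (R : realType) (K L : compactHausdorffType).
Local Notation C := (R[i]^o).

Fact cfun1_cts (T : compactHausdorffType) : continuous (fun _ : T => 1 : C).
Proof. by move=> x; exact: cvg_cst. Qed.

Definition cfun1 (T : compactHausdorffType) : cfun R T := mk_cfun (@cfun1_cts T).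

Lemma tensPl c (f f' : cfun R K) (g : cfun R L) :
  tens (c *: f + f') g = c *: tens f g + tens f' g.
Proof. apply: cfunP => p.
by rewrite -[LHS]/((c * f p.1 + f' p.1) * g p.2) mulrDl -mulrA. Qed.

Lemma tensPr c (f : cfun R K) (g g' : cfun R L) :
  tens f (c *: g + g') = c *: tens f g + tens f g'.
Proof. apply: cfunP => p.
by rewrite -[LHS]/(f p.1 * (c * g p.2 + g' p.2)) mulrDr mulrCA. Qed.

Lemma tensM (f f' : cfun R K) (g g' : cfun R L) :
  tens (cmul f f') (cmul g g') = cmul (tens f g) (tens f' g').
Proof. by apply: cfunP => p; rewrite /= mulrACA. Qed.

Lemma tens_star (f : cfun R K) (g : cfun R L) :
  cstar (tens f g) = tens (cstar f) (cstar g).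
Proof. by apply: cfunP => p; exact: rmorphM. Qed.

Lemma cmulf1 (T : compactHausdorffType) (f : cfun R T) : cmul f (cfun1 T) = f.
Proof. by apply: cfunP => p; rewrite /= mulr1. Qed.

Lemma norm_tens (f : cfun R K) (g : cfun R L) : `|tens f g| <= `|f| * `|g|.
Proof.
apply: cfun_norm_le => [|p]; first exact: mulr_ge0.
by rewrite /= normrM ler_pM ?cfun_norm_ge.
Qed.

Lemma tens0l (g : cfun R L) : tens (0 : cfun R K) g = 0.
Proof. by apply: cfunP => p; exact: mul0r. Qed.

Lemma tens0r (f : cfun R K) : tens f (0 : cfun R L) = 0.
Proof. by apply: cfunP => p; exact: mulr0. Qed.

Lemma tensBl (f f' : cfun R K) (g : cfun R L) :
  tens f g - tens f' g = tens (f - f') g.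
Proof. by rewrite -scaleN1r addrC -tensPl scaleN1r addrC. Qed.

Lemma tensBr (f : cfun R K) (g g' : cfun R L) :
  tens f g - tens f g' = tens f (g - g').
Proof. by rewrite -scaleN1r addrC -tensPr scaleN1r addrC. Qed.

Lemma closed_right_ideal_tensl (Z : set (cfun R (K * L)%type)) g :
  closed_right_ideal Z -> closed_right_ideal [set f | Z (tens f g)].
Proof.
move=> [Z0 ZP ZM Zc]; split => [|c x y Zx Zy|x d Zx|] /=.
- by rewrite tens0l.
- by rewrite tensPl; exact: ZP.
(* With [g] written as [g] times 1, multiplying the first factor by [d] becomes right multiplication
   by [tens d 1]. *)
- by rewrite -[g]cmulf1 tensM; exact: ZM.
- apply: (@closed_preimage_lipschitz _ _ _ (fun f => tens f g) `|g| Z) => // x y.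
  by rewrite tensBl mulrC norm_tens.
Qed.

Lemma closed_right_ideal_tensr (Z : set (cfun R (K * L)%type)) f :
  closed_right_ideal Z -> closed_right_ideal [set g | Z (tens f g)].
Proof.
move=> [Z0 ZP ZM Zc]; split => [|c x y Zx Zy|x d Zx|] /=.
- by rewrite tens0r.
- by rewrite tensPr; exact: ZP.
- by rewrite -[f]cmulf1 tensM; exact: ZM.
- apply: (@closed_preimage_lipschitz _ _ _ (tens f) `|f| Z) => // x y.
  by rewrite tensBr norm_tens.
Qed.

(** A closed linear span is the smallest closed subspace containing its generators, so claims about
    [tensor_set] reduce to elementary tensors. *)
Lemma tensor_set_min (A : set (cfun R K)) (B : set (cfun R L))
    (Z : set (cfun R (K * L)%type)) :
  Z 0 -> (forall (c : R[i]) x y, Z x -> Z y -> Z (c *: x + y)) -> closed Z ->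
  (forall f g, A f -> B g -> Z (tens f g)) -> tensor_set A B `<=` Z.
Proof.
move=> Z0 ZP Zc ABZ; rewrite /tensor_set closureE; apply: smallest_sub => //.
by apply: lspan_min => // _ [f Af [g Bg <-]]; exact: ABZ.
Qed.

Lemma tens_tensor_set (A : set (cfun R K)) (B : set (cfun R L)) f g :
  A f -> B g -> tensor_set A B (tens f g).
Proof.
by move=> Af Bg; apply/subset_closure/lspan_sub; exists f => //; exists g.
Qed.

Lemma tensor_set_subset (A A' : set (cfun R K)) (B B' : set (cfun R L)) :
  A `<=` A' -> B `<=` B' -> tensor_set A B `<=` tensor_set A' B'.
Proof.
move=> AA' BB'; apply: tensor_set_min => [|||f g /AA' A'f /BB' B'g].
- exact/subset_closure/lspan0.
- by apply: closure_linear; exact: lspanP.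
- exact: closed_closure.
- exact: tens_tensor_set.
Qed.

(** One factor is treated at a time: with [g] fixed, [S] generates every [f] in [I]; then with [s]
    in [S] fixed, [T] generates every [g] in [J]. *)
Lemma tensor_ideal_generators (I : closed_ideal (cfun R K))
    (J : closed_ideal (cfun R L)) S T :
  ideal_generators I S -> ideal_generators J T ->
  ideal_generators (tensor_ideal I J) [set tens f g | f in S & g in T].
Proof.
move=> [SI Sgen] [TJ Tgen]; split.
  by move=> _ [f /SI If [g /TJ Jg <-]]; exact: tens_tensor_set.
move=> Z Zr STZ; have [Z0 ZP _ Zc] := Zr.
apply: tensor_set_min => // f g If Jg.
apply: (Sgen _ (closed_right_ideal_tensl g Zr)) If => s Ss /=.
apply: (Tgen _ (closed_right_ideal_tensr s Zr)) Jg => t Tt /=.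
by apply: STZ; exists s => //; exists t.
Qed.

End TensorGenerators.

(** * Truncated functions equal to 1 where a given function is large *)

Section Plateau.
Context (R : realType) (K : compactHausdorffType).
Local Notation C := (R[i]^o).
Implicit Types (k : cfun R K) (r : R) (x : K).

Definition cfun_abs k x : R := complex.Re `|k x|.

Lemma cfun_abs_continuous k : continuous (cfun_abs k).
Proof.
move=> x.
apply: (@continuous_comp _ _ _ (fun x => `|k x| : C) (@complex.Re R)).
  apply: (@continuous_comp _ _ _ (k : K -> C) (fun z : C => `|z| : C)).
    exact: cfun_continuous.
  exact: norm_continuous.
exact: Re_continuous.
Qed.

(** The maximum with [r ^+ 2] keeps the denominator away from 0, so that the inverse is continuous
    even at zeros of [k]. *)
Definition cutoff k r x : R := (Num.max (cfun_abs k x ^+ 2) (r ^+ 2))^-1.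

Lemma cutoff_continuous k r : 0 < r ->
  continuous (fun x => (cutoff k r x)%:C : C).
Proof.
move=> r0 x; apply: (@continuous_comp _ _ _ (cutoff k r) (fun t : R => t%:C : C));
  last exact: real_complex_continuous.
apply: cvgV; first by rewrite gt_eqF// lt_max [X in _ || X]exprn_gt0 ?orbT.
apply: (@continuous_max _ _ (fun x => cfun_abs k x ^+ 2 : R^o)
  (cst (r ^+ 2 : R^o))); last exact: cvg_cst.
rewrite /prop_for/continuous_at; under eq_fun do rewrite expr2.
by apply: cvgM; exact: cfun_abs_continuous.
Qed.

(* |k|^2 / max(|k|^2, r^2), an element of each ideal that contains k. *)
Definition plateau k r (r0 : 0 < r) : cfun R K :=
  cmul k (cmul (cstar k) (mk_cfun (cutoff_continuous (k := k) r0))).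

Lemma plateauE k r (r0 : 0 < r) x :
  plateau k r0 x = (cfun_abs k x ^+ 2 * cutoff k r x)%:C.
Proof.
rewrite /= mulrA -normCK -Re_normE.
by rewrite rmorphM rmorphXn.
Qed.

Lemma plateau_eq1 k r (r0 : 0 < r) x :
  r%:C <= `|k x| -> plateau k r0 x = 1.
Proof.
rewrite -Re_normE lecR => rk; rewrite plateauE /cutoff max_l; last first.
  by rewrite ler_pXn2r ?nnegrE ?(ltW r0)// (le_trans (ltW r0)).
by rewrite divff// sqrf_eq0 gt_eqF// (lt_le_trans r0).
Qed.

(** The maximum in the denominator dominates the numerator [cfun_abs k x ^+ 2]. *)
Lemma plateau_norm k r (r0 : 0 < r) : `|plateau k r0| <= 1.
Proof.
apply: cfun_norm_le => // x; rewrite plateauE.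
rewrite ger0_norm; last first.
  by rewrite lecR mulr_ge0 ?sqr_ge0// invr_ge0 le_max sqr_ge0.
rewrite lecR /cutoff ler_pdivrMr; last by rewrite lt_max [X in _ || X]exprn_gt0 ?orbT.
by rewrite mul1r le_max lexx.
Qed.

Lemma plateau_star k r (r0 : 0 < r) : cstar (plateau k r0) = plateau k r0.
Proof.
apply: cfunP => x; rewrite -[LHS]/((plateau k r0 x)^*)%R plateauE.
exact: conjc_real.
Qed.

End Plateau.

(** * Rank-one operators on Hilbert modules *)

Section RankOne.
Context (R : realType) (D : cstarAlgType R) (Y : hilbertModType D).
Implicit Types y : Y.

Lemma rank_one_compact y y' : compact_endo (rank_one y y').
Proof.
move=> e e0; exists (rank_one y y').
  exists 1%N, (fun=> 1), (fun=> rank_one y y'); split.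
    by move=> _; exists y => //; exists y'.
  by rewrite big_ord1 scale1r.
by move=> z; rewrite subrr normr0 mulr_ge0// lecR ltW.
Qed.

(** Both sides reduce to [cmul (hinner x y) (hinner y z)]. *)
Lemma rank_one_self_adjoint y : self_adjoint (rank_one y y).
Proof.
move=> x z; rewrite /rank_one hinner_act -hinner_star hinner_act cstarM.
by rewrite !hinner_star.
Qed.

End RankOne.

(** * Local units extracted from compact containment *)

Section CompactContainment.
Context (R : realType) (K : compactHausdorffType).
Implicit Types I J : closed_ideal (cfun R K).

(** By associativity [rank_one y y'] is multiplication by [cmul y (cstar y')], which lies in [J]
    because [y] does; linear combinations of operators give linear combinations of multipliers. *)
Lemma lspan_rank_one_mul J (F : ideal_module J -> ideal_module J) :
  lspan [set rank_one y y' | y in setT & y' in setT] F ->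
  exists2 k, ideal_set J k & forall z, \val (F z) = cmul k (\val z).
Proof.
move=> [n [c [s [Ss ->]]]]; elim/big_ind : _ => [|u v|i _].
- by exists 0; [exact: ideal0 | move=> z; rewrite cmul0l].
- move=> [k Jk kE] [l Jl lE]; exists (k + l).
    by rewrite -[k]scale1r; exact: idealP.
  by move=> z; rewrite cmulDl -kE -lE.
- have [y _ [y' _ <-]] := Ss i.
  exists (c i *: cmul (\val y) (cstar (\val y'))).
    rewrite -[_ *: _]addr0; apply: idealP; last exact: ideal0.
    by apply: Defs.idealMr; exact/set_mem/(valP y).
  by move=> z; rewrite cmulZl -cmulA.
Qed.

Lemma compactly_contained_local_unit I J : ideal_compactly_contained I J ->
  exists g, [/\ ideal_set J g, cstar g = g &
                forall x, ideal_set I x -> cmul g x = x].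
Proof.
move=> [IJ [_ _ [b [bc _ bI]]]].
(* The value 1/2 is both the approximation error for [b] and the threshold of the plateau, as 1 -
   1/2 = 1/2. *)
have r0 : 0 < 2^-1 :> R by rewrite invr_gt0.
have [F /lspan_rank_one_mul[k Jk kE] bF] := bc _ r0.
exists (plateau k r0); split; [exact: Defs.idealMr|exact: plateau_star|].
move=> x Ix; apply: cfunP => p.
have [xp0|xp0] := eqVneq (x p : R[i]) 0.
  by rewrite -[LHS]/(plateau k r0 p * x p) xp0 mulr0.
rewrite -[LHS]/(plateau k r0 p * x p) plateau_eq1 ?mul1r//.
have s0 : 0 < cfun_abs x p by rewrite -ltcR Re_normE normr_gt0.
(* An element of the unit ball of I with value 1 at p. *)
pose u := plateau x s0.
have Iu : ideal_set I u by exact: Defs.idealMr.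
have up : u p = 1 by apply: plateau_eq1; rewrite Re_normE.
pose z : ideal_module J := Sub u (mem_set (IJ _ Iu)).
have bz : b z = z by apply: bI; exact/mem_set.
have uk : `|u - cmul k u| <= (2^-1)%:C * `|u|.
  by have := bF z; rewrite bz -[cmul k u](kE z).
(* Evaluation at [p], where [u] is 1, isolates [1 - k p]; the bound [|u| <= 1] turns the error
   relative to [|u|] into an absolute one. *)
have kp : `|1 - k p : R[i]| <= (2^-1)%:C.
  have := cfun_norm_ge (u - cmul k u) p.
  rewrite -[X in `|X| <= _]/(u p - k p * u p) up mulr1 => /le_trans; apply.
  by rewrite (le_trans uk)// ler_piMr ?plateau_norm// lecR ltW.
have half : 1 = (2^-1)%:C + (2^-1)%:C :> R[i].
  by rewrite -rmorphD /= -[2^-1]mul1r -splitr.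
(* Adding 1/2 to both sides leaves the triangle inequality for 1 = (1 - [k p]) + [k p]. *)
rewrite -(lerD2l (2^-1)%:C) -half (le_trans _ (lerD kp (lexx _)))//.
by rewrite (le_trans _ (ler_normD _ _))// subrK normr1.
Qed.

End CompactContainment.

(** * Tensor products of local units and the final assembly *)

Lemma tens_local_unit (R : realType) (K L : compactHausdorffType)
    (A : set (cfun R K)) (B : set (cfun R L)) g h :
  (forall x, A x -> cmul g x = x) -> (forall y, B y -> cmul h y = y) ->
  forall z, tensor_set A B z -> cmul (tens g h) z = z.
Proof.
(* The fixed points of multiplication by [G] form a closed subspace, so elementary tensors
   suffice. *)
move=> gA hB; set G := tens g h; pose Z := [set z | cmul G z = z].
apply: (@tensor_set_min _ _ _ _ _ Z) => [|c x y Gx Gy||x y Ax By].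
- by rewrite /Z/= cmul0r.
- by rewrite /Z/= cmulDr cmulZr Gx Gy.
(* [Z] is the zero set of [cmul G x - x], a Lipschitz map with constant [|G| + 1]. *)
- rewrite (_ : Z = (fun x => cmul G x - x) @^-1` [set 0]).
    apply: (@closed_preimage_lipschitz _ _ _ _ (`|G| + 1)) => [|x y|].
    + by rewrite addr_ge0.
    + rewrite opprD addrACA -opprD -cmulNr -cmulDr.
      rewrite (le_trans (ler_normB _ _))// mulrDl mul1r lerD2r.
      exact: cnormM_le.
    + apply: accessible_closed_set1; apply: hausdorff_accessible.
      exact: norm_hausdorff.
  by apply/seteqP; split => x /=; [move=> ->; rewrite subrr | move/subr0_eq].
- by rewrite /Z/= -tensM gA// hB.
Qed.

Lemma countable_tens (R : realType) (K L : compactHausdorffType)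
    (S : set (cfun R K)) (T : set (cfun R L)) :
  countable S -> countable T -> countable [set tens f g | f in S & g in T].
Proof.
move=> Sc Tc; apply: sub_countable (countableX Sc Tc).
apply: card_le_trans (card_image_le (fun p => tens p.1 p.2) _).
by apply: subset_card_le => _ [f Sf [g Tg <-]]; exists (f, g).
Qed.

Theorem proposition3p1 (R : realType) (K : compactHausdorffType)
    (I1 I2 J1 J2 : closed_ideal (cfun R K)) :
  countably_generated [set: ideal_module I1] ->
  countably_generated [set: ideal_module I2] ->
  countably_generated [set: ideal_module J1] ->
  countably_generated [set: ideal_module J2] ->
  ideal_compactly_contained I1 J1 ->
  ideal_compactly_contained I2 J2 ->
  ideal_compactly_contained (tensor_ideal I1 I2) (tensor_ideal J1 J2).
Proof.
move=> /countably_generated_generators[S1 S1c S1I].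
move=> /countably_generated_generators[S2 S2c S2I].
move=> /countably_generated_generators[T1 T1c T1J].
move=> /countably_generated_generators[T2 T2c T2J] IJ1 IJ2.
have IJ : tensor_ideal I1 I2 `<=` tensor_ideal J1 J2.
  exact: tensor_set_subset IJ1.1 IJ2.1.
have [g1 [Jg1 g1_star g1I]] := compactly_contained_local_unit IJ1.
have [g2 [Jg2 g2_star g2I]] := compactly_contained_local_unit IJ2.
pose G : ideal_module (tensor_ideal J1 J2) :=
  Sub (tens g1 g2) (mem_set (tens_tensor_set Jg1 Jg2)).
have G_star : cstar (\val G) = \val G.
  by rewrite -[\val G]/(tens g1 g2) tens_star g1_star g2_star.
split; first exact: IJ.
split.
- apply: generators_countably_generated IJ (countable_tens S1c S2c) _.
  exact: tensor_ideal_generators.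
(* The whole module is rewritten as the ideal sitting inside itself, so that the same generation
   lemma applies with equal ideals. *)
- rewrite (_ : setT = [set x : ideal_module (tensor_ideal J1 J2) |
                         ideal_set (tensor_ideal J1 J2) (\val x)]).
    apply: generators_countably_generated (countable_tens T1c T2c) _ => //.
    exact: tensor_ideal_generators.
  by apply/seteqP; split => // x _; exact/set_mem/(valP x).
- exists (rank_one G G); split.
  + exact: rank_one_compact.
  + exact: rank_one_self_adjoint.
  + move=> x /set_mem Ix; apply: val_inj.
    (* The operator multiplies by [cstar G] and then by [G]; as [G] is self-adjoint, the local unit
       property is used twice. *)
    rewrite -[LHS]/(cmul (\val G) (cmul (cstar (\val G)) (\val x))) G_star.
    by rewrite !(tens_local_unit g1I g2I).
Qed.
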